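(* Let $\mathcal{P}=(\Omega,\Lambda,\star)$ be an ABQR operad over $\mathbf{k}$ and let $(\alpha,\beta)$ be a unit action on $\mathcal{P}$. (1) The unit action $(\alpha,\beta)$ is coherent if and only if, for every element $$\Big(\sum_{i}\odot^{(1)}_i\otimes \odot^{(2)}_i,\ \sum_j\odot^{(3)}_j\otimes \odot^{(4)}_j\Big)\in \Lambda$$ (with all $\odot^{(1)}_i,\odot^{(2)}_i,\odot^{(3)}_j,\odot^{(4)}_j\in\Omega$), the following five equations hold in $\Omega$: (C1) $\sum_i \beta(\odot^{(1)}_i)\,\odot^{(2)}_i = \sum_j \beta(\odot^{(3)}_j)\,\odot^{(4)}_j$, (C2) $\sum_i \alpha(\odot^{(1)}_i)\,\odot^{(2)}_i = \sum_j \beta(\odot^{(4)}_j)\,\odot^{(3)}_j$, (C3) $\sum_i \alpha(\odot^{(2)}_i)\,\odot^{(1)}_i = \sum_j \alpha(\odot^{(4)}_j)\,\odot^{(3)}_j$, (C4) $\sum_i \beta(\odot^{(2)}_i)\,\odot^{(1)}_i = \sum_j \beta(\odot^{(3)}_j)\beta(\odot^{(4)}_j)\,\star$, (C5) $\sum_i \alpha(\odot^{(1)}_i)\alpha(\odot^{(2)}_i)\,\star = \sum_j \alpha(\odot^{(3)}_j)\,\odot^{(4)}_j$. (2) The unit action $(\alpha,\beta)$ is compatible if and only if, for every element $\big(\sum_{i}\odot^{(1)}_i\otimes \odot^{(2)}_i,\ \sum_j\odot^{(3)}_j\otimes \odot^{(4)}_j\big)\in \Lambda$, equations (C1), (C2)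 and (C3) above hold.
   Context: $\mathbf{k}$ is a field of characteristic zero. A binary quadratic regular operad is given by a pair $(\Omega,\Lambda)$, where $\Omega$ is a finite-dimensional $\mathbf{k}$-vector space (the generators, i.e. binary operations) and $\Lambda$ is a subspace of $\Omega^{\otimes 2}\oplus\Omega^{\otimes 2}$ (the relations). A $\mathcal{P}$-algebra for $\mathcal{P}=(\Omega,\Lambda)$ is a $\mathbf{k}$-vector space $A$ with a bilinear operation $(x,y)\mapsto x\odot y$ for each $\odot\in\Omega$, depending linearly on $\odot$, such that for each $(\sum_i \odot^{(1)}_i\otimes\odot^{(2)}_i,\sum_j\odot^{(3)}_j\otimes\odot^{(4)}_j)\in\Lambda$ one has $$\sum_i (x\odot^{(1)}_i y)\odot^{(2)}_i z=\sum_j x\odot^{(3)}_j(y\odot^{(4)}_j z)\quad\text{for all }x,y,z\in A.$$ An ABQR operad is a triple $(\Omega,\Lambda,\star)$ where $\Omega$ is a finite-dimensional $\mathbf{k}$-vector space, $\Lambda$ is a subspace of $\Omega^{\otimes 2}\oplus\Omega^{\otimes 2}$ (so that $(\Omega,\Lambda)$ is a binary quadratic regular operad), and $\star\in\Omega$ is a chosen element with $(\star\otimes\star,\star\otimes\star)\in\Lambda$ (so $\star$ is associative in every algebra). A unit action on $(\Omega,\Lambda,\star)$ is a pair of linear maps $\alpha,\beta:\Omega\to\mathbf{k}$ with $\alpha(\star)=\beta(\star)=1$. For a $\mathcal{P}$-algebra $A$ put $A_+=\mathbf{k}1\oplus A$. Each $\odot\in\Omega$ is extended to a partially defined bilinear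 operation $\tilde\odot$ on $A_+$: $a\,\tilde\odot\, b=a\odot b$ for $a,b\in A$; $a\,\tilde\odot\,1=\alpha(\odot)a$ for $a\in A$; $1\,\tilde\odot\,b=\beta(\odot)b$ for $b\in A$; $1\,\tilde\star\,1=1$; and $1\,\tilde\odot\,1$ is undefined for $\odot\ne\star$. The unit action is compatible if the relations of $\mathcal{P}$ remain valid on $A_+$ for each $\mathcal{P}$-algebra $A$ whenever the terms are defined: for every $(\sum_i \odot^{(1)}_i\otimes\odot^{(2)}_i,\sum_j\odot^{(3)}_j\otimes\odot^{(4)}_j)\in\Lambda$ one has $\sum_i (x\,\tilde\odot^{(1)}_i y)\,\tilde\odot^{(2)}_i z=\sum_j x\,\tilde\odot^{(3)}_j(y\,\tilde\odot^{(4)}_j z)$ for all $x,y,z\in A_+$ for which both sides make sense. For $\mathcal{P}$-algebras $A,B$ let $A\boxtimes B=(A\otimes\mathbf{k}1)\oplus(\mathbf{k}1\otimes B)\oplus(A\otimes B)\subset A_+\otimes B_+$, and for $\odot\in\Omega$ define a bilinear operation $\boxdot$ on $A\boxtimes B$ by $(a\otimes b)\boxdot(a'\otimes b')=(a\,\tilde\star\,a')\otimes(b\,\tilde\odot\,b')$ if $b\otimes b'\neq 1\otimes1$, and $(a\otimes b)\boxdot(a'\otimes b')=(a\,\tilde\odot\,a')\otimes1$ if $b\otimes b'=1\otimes 1$ (here $b,b'$ each are $1$ or in $B$, and likewise $a,a'$ each are $1$ or in $A$). A (compatible) unit action is coherent if, for all $\mathcal{P}$-algebras $A$ and $B$, $A\boxtimes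 B$ with these operations is again a $\mathcal{P}$-algebra. *)

(* Defs.v *)
From HB Require Import structures.
From mathcomp Require Import all_boot all_algebra.
From mathcomp Require Import generic_quotient ring_quotient.
From mathcomp Require Import boolp.
From mathcomp Require Import freeg.

Set Implicit Arguments.
Unset Strict Implicit.
Unset Printing Implicit Defensive.

Import GRing.Theory.
Local Open Scope ring_scope.
Local Open Scope quotient_scope.

(* The tensor product of two (possibly infinite-dimensional) vector spaces:
   the free vector space on U * V modulo the subspace generated by the
   bilinearity relations. *)
Section Tensor.
Variables (k : fieldType) (U V : lmodType k).

Local Notation F := {freeg (U * V)%type / k}.

Definition free_pair (u : U) (v : V) : F := << (u, v) >>.

Definition bilinear_relators (S : {pred F}) : Prop :=
  (forall (c : k) (u u' : U) (v : V),
     free_pair (c *: u + u') v - (c *: free_pair u v + free_pair u' v) \in S) /\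
  (forall (c : k) (u : U) (v v' : V),
     free_pair u (c *: v + v') - (c *: free_pair u v + free_pair u v') \in S).

Definition bilinear_span : {pred F} := fun w =>
  `[< forall S : submodClosed F, bilinear_relators S -> w \in (S : {pred F}) >].

Lemma bilinear_span_submod : submod_closed bilinear_span.
Proof.
split=> [|c w w' /asboolP Sw /asboolP Sw']; apply/asboolP=> S HS.
  exact: rpred0.
by rewrite rpredD ?rpredZ ?Sw ?Sw'.
Qed.

HB.instance Definition _ :=
  GRing.isSubmodClosed.Build k F bilinear_span bilinear_span_submod.

Local Notation Q := (ring_quotient.Quotient.quot bilinear_span).

Definition tensor : Type := Q.

HB.instance Definition _ := GRing.Zmodule.on tensor.

Local Notation pi := (\pi_Q).

Definition tensor_scale (c : k) (t : tensor) : tensor := pi (c *: repr t).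

Let pi_eqP (w w' : F) : reflect (pi w = pi w') (w - w' \in bilinear_span).
Proof. by rewrite ring_quotient.Quotient.idealrBE; apply: eqP. Qed.

Let piZ (c : k) (w : F) : tensor_scale c (pi w) = pi (c *: w).
Proof.
apply/pi_eqP; rewrite -scalerBr; apply: rpredZ; apply/pi_eqP.
exact: reprK.
Qed.

Let piD (w w' : F) : pi (w + w') = pi w + pi w' :> Q.
Proof. exact: raddfD. Qed.

Let piW (t : tensor) : exists w : F, t = pi w.
Proof. by exists (repr (t : Q)); rewrite reprK. Qed.

Fact tensor_scaleA (a b : k) (t : tensor) :
  tensor_scale a (tensor_scale b t) = tensor_scale (a * b) t.
Proof. by have [w ->] := piW t; rewrite !piZ scalerA. Qed.

Fact tensor_scale1 : left_id 1 tensor_scale.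
Proof. by move=> t; have [w ->] := piW t; rewrite piZ scale1r. Qed.

Fact tensor_scaleDr : right_distributive tensor_scale +%R.
Proof.
move=> c t t'; have [w ->] := piW t; have [w' ->] := piW t'.
by rewrite -[_ + _]piD !piZ scalerDr piD.
Qed.

Fact tensor_scaleDl (t : tensor) : {morph tensor_scale^~ t : a b / a + b}.
Proof. by move=> a b; have [w ->] := piW t; rewrite !piZ scalerDl piD. Qed.

HB.instance Definition _ := GRing.Zmodule_isLmodule.Build k tensor
  tensor_scaleA tensor_scale1 tensor_scaleDr tensor_scaleDl.

Definition tensor_pi (w : F) : tensor := pi w.

Fact tensor_pi_linear : linear tensor_pi.
Proof. by move=> c w w'; rewrite /tensor_pi piD -piZ. Qed.

HB.instance Definition _ := GRing.isLinear.Build k F tensor _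
  tensor_pi tensor_pi_linear.

Definition tens (u : U) (v : V) : tensor := tensor_pi (free_pair u v).

Lemma tens_linearl (v : V) : linear (tens^~ v).
Proof.
by move=> c u u'; rewrite -linearP; apply/pi_eqP/asboolP=> S [].
Qed.

Lemma tens_linearr (u : U) : linear (tens u).
Proof.
by move=> c v v'; rewrite -linearP; apply/pi_eqP/asboolP=> S [].
Qed.

Lemma tens_span (t : tensor) :
  exists s : seq (U * V), t = \sum_(p <- s) tens p.1 p.2.
Proof.
have [w ->] := piW t; rewrite -[pi w]/(tensor_pi w) -[w]freeg_sumE.
exists [seq (coeff p w *: p.1, p.2) | p <- dom w].
rewrite raddf_sum [RHS]big_map; apply: eq_bigr => -[u v] _ /=.
have tens0 : tens 0 v = 0.
  have := tens_linearl v (-1) 0 0.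
  by rewrite scaler0 addr0 scaleN1r addNr.
have := tens_linearl v (coeff (u, v) w) u 0.
rewrite addr0 tens0 addr0 => ->; rewrite -linearZ; congr tensor_pi.
by apply/eqP/freeg_eqP => x; rewrite coeffZ !coeffU mul1r.
Qed.

Section Universal.
Variables (W : lmodType k) (f : U -> V -> W).
Hypotheses (fl : forall v, linear (f^~ v)) (fr : forall u, linear (f u)).

Let g : F -> W := fglift (fun p : U * V => f p.1 p.2).

Lemma fglift_lin : linear g.
Proof.
have gD : {morph g : x y / x - y} by exact: lift_is_additive.
pose ga := GRing.isZmodMorphism.Build F W g gD.
pose G : {additive F -> W} := HB.pack g ga.
have gE (w : F) : g w = \sum_(x <- dom w) coeff x w *: f x.1 x.2.
  rewrite -{1}[w]freeg_sumE; transitivity (\sum_(x <- dom w) G << coeff x w *g x >>).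
    exact: (raddf_sum G).
  by apply: eq_bigr => x _; exact: liftU.
move=> c x y; rewrite [LHS](raddfD G); congr (_ + _).
rewrite [LHS](raddf_sum G) gE scaler_sumr.
by apply: eq_bigr => z _; rewrite scalerA; exact: liftU.
Qed.

Lemma tensor_universal :
  exists2 h : tensor -> W, linear h & forall u v, h (tens u v) = f u v.
Proof.
have gP (c : k) (x y : F) : g (c *: x + y) = c *: g x + g y := fglift_lin c x y.
have gB (x y : F) : g (x - y) = g x - g y := lift_is_additive _ x y.
have gU u v : g (free_pair u v) = f u v by rewrite /g liftU scale1r.
have g0 : g 0 = 0 by rewrite -(subrr 0) gB subrr.
have kerg : submod_closed (fun w => g w == 0).
  split=> [|c x y]; first by rewrite unfold_in g0.
  by rewrite !unfold_in gP => /eqP-> /eqP->; rewrite scaler0 addr0.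
pose kc := GRing.isSubmodClosed.Build k F (fun w => g w == 0) kerg.
pose K : submodClosed F := HB.pack (fun w => g w == 0) kc.
have flP c u u' v : f (c *: u + u') v = c *: f u v + f u' v := fl v c u u'.
have frP c u v v' : f u (c *: v + v') = c *: f u v + f u v' := fr u c v v'.
have gpi (w w' : F) : pi w = pi w' -> g w = g w'.
  move/pi_eqP/asboolP=> /(_ K) H; apply/eqP; rewrite -subr_eq0 -gB.
  apply: H; split=> *; apply/eqP.
    by rewrite gB gP 3!gU flP subrr.
  by rewrite gB gP 3!gU frP subrr.
exists (fun t : tensor => g (repr (t : Q))) => [c t t'|u v].
  rewrite -fglift_lin; apply: gpi; rewrite reprK piD -piZ.
  by rewrite !reprK.
by rewrite -gU; apply: gpi; rewrite reprK.
Qed.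

End Universal.

End Tensor.

Arguments tens {k U V}.
Notation "u ⊗ v" := (tens u v) (at level 40, left associativity) : ring_scope.

(* Submodules of an lmodType are bundled boolean predicates; with the classical
   axioms of boolp these are all of its vector subspaces. *)
Record bqr_operad (k : fieldType) := BQROperad {
  generators : vectType k;
  relations : submodClosed
    (tensor generators generators * tensor generators generators)%type
}.

Record abqr_operad (k : fieldType) := ABQROperad {
  abqr_bqr :> bqr_operad k;
  star : generators abqr_bqr;
  star_assoc : (star ⊗ star, star ⊗ star) \in (relations abqr_bqr : {pred _})
}.

Section Algebras.
Variables (k : fieldType) (P : bqr_operad k).
Local Notation Omega := (generators P).

(* The lists s and t present the two components of an element of Lambda as
   sums of decomposable tensors. *)
Definition is_relation (s t : seq (Omega * Omega)) : Prop :=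
  (\sum_(p <- s) p.1 ⊗ p.2, \sum_(q <- t) q.1 ⊗ q.2)
    \in (relations P : {pred _}).

Definition is_algebra (A : lmodType k) (op : Omega -> A -> A -> A) : Prop :=
  [/\ forall x y, linear (fun o => op o x y),
      forall o y, linear (fun x => op o x y),
      forall o x, linear (fun y => op o x y) &
      forall s t, is_relation s t -> forall x y z,
        \sum_(p <- s) op p.2 (op p.1 x y) z =
        \sum_(q <- t) op q.1 x (op q.2 y z)].

Record algebra := Algebra {
  carrier :> lmodType k;
  alg_op : Omega -> carrier -> carrier -> carrier;
  algP : is_algebra alg_op
}.

End Algebras.

Section UnitActions.
Variables (k : fieldType) (P : abqr_operad k).
Local Notation Omega := (generators P).

Record unit_action := UnitAction {
  alpha : {linear Omega -> k^o};
  beta : {linear Omega -> k^o};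
  alpha_star : alpha (star P) = 1;
  beta_star : beta (star P) = 1
}.

(* A_+ = k1 + A; the unit 1 is (1, 0). *)
Definition plus (A : lmodType k) : lmodType k := (k^o * A)%type.

(* None is the unit 1 and Some a is the element a of A. *)
Definition in_plus (A : lmodType k) (x : option A) : plus A :=
  if x is Some a then (0, a) else (1, 0).

Arguments in_plus {A} x : simpl never.

Variable u : unit_action.

(* By bilinearity (r1 + a) o (s1 + b) involves the term rs (1 o 1), which is
   undefined unless o is star or rs = 0. *)
Definition ext_op (A : algebra P) (o : Omega) (x y : plus A) :
    option (plus A) :=
  if (o == star P) || (x.1 * y.1 == 0) then
    Some (x.1 * y.1,
          (y.1 * alpha u o) *: x.2 + (x.1 * beta u o) *: y.2
          + alg_op o x.2 y.2)
  else None.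

(* A sum makes sense when all of its terms do. *)
Definition oadd (V : zmodType) (x y : option V) : option V :=
  obind (fun v => omap (+%R v) y) x.

Definition compatible : Prop :=
  forall (A : algebra P) (s t : seq (Omega * Omega)), is_relation s t ->
  forall x y z l r : plus A,
    \big[@oadd _ / Some 0]_(p <- s)
       obind (fun w => ext_op p.2 w z) (ext_op p.1 x y) = Some l ->
    \big[@oadd _ / Some 0]_(q <- t)
       obind (ext_op q.1 x) (ext_op q.2 y z) = Some r ->
    l = r.

Section BoxTensor.
Variables A B : lmodType k.
Local Notation T := (tensor (plus A) (plus B)).

(* (A ⊗ k1) + (k1 ⊗ B) + (A ⊗ B) inside A_+ ⊗ B_+ *)
Definition box_pred : {pred T} := fun w =>
  `[< exists (a : A) (b : B) (s : seq (A * B)),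
        w = in_plus (Some a) ⊗ in_plus None + in_plus None ⊗ in_plus (Some b)
            + \sum_(p <- s) in_plus (Some p.1) ⊗ in_plus (Some p.2) >].

Lemma in_plusP (V : lmodType k) (c : k) (v v' : V) :
  in_plus (Some (c *: v + v')) = c *: in_plus (Some v) + in_plus (Some v').
Proof. by congr pair; rewrite /= scaler0 addr0. Qed.

Lemma box_pred_submod : submod_closed box_pred.
Proof.
have tD1 (x y : plus A) (z : plus B) c :
    (c *: x + y) ⊗ z = c *: (x ⊗ z) + y ⊗ z.
  exact: tens_linearl.
have tD2 (x : plus A) (y z : plus B) c :
    x ⊗ (c *: y + z) = c *: (x ⊗ y) + x ⊗ z.
  exact: tens_linearr.
have t01 (z : plus B) : (0 : plus A) ⊗ z = 0.
  by have := tD1 0 0 z (-1); rewrite scaler0 addr0 scaleN1r addNr.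
have t02 (z : plus A) : z ⊗ (0 : plus B) = 0.
  by have := tD2 z 0 0 (-1); rewrite scaler0 addr0 scaleN1r addNr.
have i0 (V : lmodType k) : in_plus (Some (0 : V)) = 0 by [].
split=> [|c w w' /asboolP[a [b [s ->]]] /asboolP[a' [b' [s' ->]]]].
  by apply/asboolP; exists 0, 0, [::]; rewrite !i0 t01 t02 big_nil !addr0.
apply/asboolP; exists (c *: a + a'), (c *: b + b').
exists ([seq (c *: p.1, p.2) | p <- s] ++ s').
rewrite big_cat big_map /= !in_plusP tD1 tD2 !scalerDr scaler_sumr.
rewrite addrACA [X in X + _ = _]addrACA;
  congr (_ + _ + (_ + _)); apply: eq_bigr => p _.
have := tD1 (in_plus (Some p.1)) 0 (in_plus (Some p.2)) c.
rewrite t01 !addr0 => <-; congr (_ ⊗ _).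
by have := in_plusP c p.1 0; rewrite i0 !addr0.
Qed.

HB.instance Definition _ :=
  GRing.isSubmodClosed.Build k T box_pred box_pred_submod.

Record box := Box { box_val : T; _ : box_val \in box_pred }.

HB.instance Definition _ := [isSub for box_val].
HB.instance Definition _ := [Choice of box by <:].
HB.instance Definition _ := [SubChoice_isSubLmodule of box by <:].

End BoxTensor.

(* The formulas for the operations on A ⊠ B, on the spanning elements a ⊗ b
   with a in A or a = 1 and b in B or b = 1; 1 ⊗ 1 is not in A ⊠ B, so the
   extended operations used here are always defined. *)
Definition box_formulas (A B : algebra P)
    (op : Omega -> box A B -> box A B -> box A B) : Prop :=
  forall (o : Omega) (a a' : option A) (b b' : option B) (x x' : box A B),
    box_val x = in_plus a ⊗ in_plus b ->
    box_val x' = in_plus a' ⊗ in_plus b' ->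
    Some (box_val (op o x x')) =
      match b, b' with
      | None, None =>
          omap (fun c => c ⊗ in_plus None) (ext_op o (in_plus a) (in_plus a'))
      | _, _ =>
          obind (fun c => omap (tens c) (ext_op o (in_plus b) (in_plus b')))
                (ext_op (star P) (in_plus a) (in_plus a'))
      end.

(* Bilinear operations on A ⊠ B are determined by the formulas. *)
Definition coherent : Prop :=
  forall A B : algebra P,
  exists op : Omega -> box A B -> box A B -> box A B,
    box_formulas op /\ is_algebra op.

End UnitActions.

(* Main.v *)
Require Import Defs.
From HB Require Import structures.
From mathcomp Require Import all_boot all_algebra.
From mathcomp Require Import boolp functions.
From mathcomp Require Import ring.

(** Both parts come down to evaluating a relation of the operad on triples of
    generators, where units and scalars collapse it to an identity between
    single operations.  Call (C1) to (C5) the five equations of the theorem, in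
    order, and let o1, o2 and o3, o4 stand for the operations in the two sides
    of a relation.

    Compatibility.  Write elements of A_+ as r1 + a.  The A-component of an
    extended product, taken to be 0 at 1, 1, is a total multilinear map
    [plus_act], and both sides of a relation at r1 + a, s1 + b, t1 + c expand
    into seven sums ([plus_act_suml], [plus_act_sumr]).
    The terms in ab, ac, bc are matched by (C3), (C2), (C1), the term in abc by
    the relation in A, and the term in b by applying alpha to (C1).  The terms
    in a and c are matched by alpha of (C3) and beta of (C1), except that
    only alpha(o3) or beta(o2) shows up where alpha(o3) alpha(o4) or
    beta(o1) beta(o2) is wanted; but these terms carry the coefficients st and
    rs, and if such a coefficient is not 0, definedness forces o4, or o1, to be
    the star.  This is [plus_relation].

    Coherence.  The operations on A ⊠ B are the restriction of one multilinear
    map [box_mul] on the whole of A_+ ⊗ B_+.  The space A ⊠ B is spanned by the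
    elements x ⊗ b with x in A_+ and by the elements a ⊗ 1, so a relation has to
    be checked on eight kinds of triples.  Three b's give the relation in B,
    three a's the relation in A, the pattern a, b, a gives alpha of (C1), and
    the five other patterns give exactly (C1) to (C5), once the associativity of
    the extended star is used on A_+ ([box_relation]).

    For the converses it is enough to have one algebra in which an operation is
    determined by its value at a single pair of elements.  Since relations only
    involve triple products, any space with vanishing triple products is an
    algebra; [null_algebra] is k + Omega with o(e, e) = o, and the same triples
    as above, filled with e and 1, give back the equations. *)

Set Implicit Arguments.
Unset Strict Implicit.
Unset Printing Implicit Defensive.

Import GRing.Theory.
Local Open Scope ring_scope.

(** * Unbundled linear maps *)

Section Linear.
Variables (k : fieldType) (U V W : lmodType k).

Lemma lin0 (f : U -> V) : linear f -> f 0 = 0.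
Proof.
by move=> fl; have := fl (-1) 0 0; rewrite scaler0 addr0 scaleN1r addNr.
Qed.

Lemma linD (f : U -> V) : linear f -> {morph f : x y / x + y}.
Proof. by move=> fl x y; have := fl 1 x y; rewrite !scale1r. Qed.

Lemma linZ (f : U -> V) : linear f -> forall c, {morph f : x / c *: x}.
Proof. by move=> fl c x; have := fl c x 0; rewrite lin0 // !addr0. Qed.

Lemma lin_sum (f : U -> V) I (r : seq I) (F : I -> U) :
  linear f -> f (\sum_(i <- r) F i) = \sum_(i <- r) f (F i).
Proof.
by move=> fl; apply: (big_morph f); [apply: linD | apply: lin0].
Qed.

Lemma lin_sumZ (f : U -> V) I (r : seq I) (c : I -> k) (F : I -> U) :
  linear f -> \sum_(i <- r) c i *: f (F i) = f (\sum_(i <- r) c i *: F i).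
Proof.
by move=> fl; rewrite lin_sum //; apply: eq_bigr => i _; rewrite linZ.
Qed.

Lemma linear_bigsum I (r : seq I) (F : I -> U -> V) :
  (forall i, linear (F i)) -> linear (fun x => \sum_(i <- r) F i x).
Proof.
move=> Fl c x y; rewrite scaler_sumr -big_split /=.
by apply: eq_bigr => i _; rewrite Fl.
Qed.

Lemma linear_comp (g : V -> W) (f : U -> V) :
  linear g -> linear f -> linear (fun x => g (f x)).
Proof. by move=> gl fl c x y; rewrite fl gl. Qed.

Lemma linear_add (f g : U -> V) :
  linear f -> linear g -> linear (fun x => f x + g x).
Proof. by move=> fl gl c x y; rewrite fl gl scalerDr addrACA. Qed.

Lemma linear_scale (c : k) (f : U -> V) :
  linear f -> linear (fun x => c *: f x).
Proof.
by move=> fl d x y; rewrite fl scalerDr !scalerA [d * c]mulrC.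
Qed.

Lemma linear_form (f : U -> k^o) (v : V) :
  linear f -> linear (fun x => f x *: v).
Proof. by move=> fl c x y; rewrite fl scalerDl -scalerA. Qed.

End Linear.

(** * Maps out of a tensor product *)

Section TensorMaps.
Variable k : fieldType.

Lemma tens0l (U V : lmodType k) (v : V) : (0 : U) ⊗ v = 0.
Proof. exact: (lin0 (tens_linearl v)). Qed.

Lemma tens0r (U V : lmodType k) (u : U) : u ⊗ (0 : V) = 0.
Proof. exact: (lin0 (tens_linearr u)). Qed.

Lemma tensor_ext (U V W : lmodType k) (h h' : tensor U V -> W) :
  linear h -> linear h' -> (forall u v, h (u ⊗ v) = h' (u ⊗ v)) -> h =1 h'.
Proof.
move=> hl hl' hh t; have [s ->] := tens_span t.
by rewrite !lin_sum //; apply: eq_bigr => p _; rewrite hh.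
Qed.

(** Maps defined on pairs of tensors come from the universal property used
    twice: for fixed u, v it gives a map out of the second tensor product, and
    these maps depend bilinearly on u, v, as elements of a function space. *)
Lemma tensor_bilinear_universal (U V U' V' W : lmodType k)
    (f : U -> V -> U' -> V' -> W) :
  (forall v u' v', linear (fun u => f u v u' v')) ->
  (forall u u' v', linear (fun v => f u v u' v')) ->
  (forall u v v', linear (fun u' => f u v u' v')) ->
  (forall u v u', linear (f u v u')) ->
  exists H : tensor U V -> tensor U' V' -> W,
    [/\ forall t', linear (H^~ t'), forall t, linear (H t) &
        forall u v u' v', H (u ⊗ v) (u' ⊗ v') = f u v u' v'].
Proof.
move=> f1 f2 f3 f4.
have /choice[g gP] (p : U * V) : exists h : tensor U' V' -> W,
    linear h /\ forall u' v', h (u' ⊗ v') = f p.1 p.2 u' v'.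
  have [h hl hE] := tensor_universal (f3 p.1 p.2) (f4 p.1 p.2).
  by exists h.
have gl p : linear (g p) by case: (gP p).
have gE p u' v' : g p (u' ⊗ v') = f p.1 p.2 u' v' by case: (gP p).
pose FW : lmodType k := (tensor U' V' -> W).
have g1 v : linear (fun u => (g (u, v) : FW)).
  move=> c x y; apply/funext => t /=.
  rewrite -[RHS]/(c *: g (x, v) t + g (y, v) t); move: t; apply: tensor_ext.
  - exact: gl.
  - by apply: linear_add => //; apply: linear_scale.
  - by move=> u' v'; rewrite !gE f1.
have g2 u : linear (fun v => (g (u, v) : FW)).
  move=> c x y; apply/funext => t /=.
  rewrite -[RHS]/(c *: g (u, x) t + g (u, y) t); move: t; apply: tensor_ext.
  - exact: gl.
  - by apply: linear_add => //; apply: linear_scale.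
  - by move=> u' v'; rewrite !gE f2.
have [H Hl HE] := tensor_universal g1 g2.
exists H; split.
- by move=> t' c x y; rewrite Hl.
- move=> t; have [s ->] := tens_span t; rewrite lin_sum // => c x y.
  rewrite !fct_sumE scaler_sumr -big_split /=; apply: eq_bigr => p _.
  by rewrite HE gl.
- by move=> u v u' v'; rewrite HE gE.
Qed.

End TensorMaps.

(** * The product on A_+ *)

Local Notation one := (in_plus None).
Local Notation inj a := (in_plus (Some a)).

Section PlusProduct.
Variables (k : fieldType) (P : abqr_operad k) (u : unit_action P).
Local Notation Omega := (generators P).
Local Notation al := (alpha u).
Local Notation be := (beta u).

Section Algebra.
Variable A : algebra P.

Lemma alg_linear_gen (x y : A) : linear (fun o : Omega => alg_op o x y).
Proof. by case: (algP A). Qed.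

Lemma alg_linearl o (y : A) : linear (fun x : A => alg_op o x y).
Proof. by case: (algP A). Qed.

Lemma alg_linearr o (x : A) : linear (fun y : A => alg_op o x y).
Proof. by case: (algP A). Qed.

Lemma alg_relation s t : is_relation s t -> forall x y z : A,
  \sum_(p <- s) alg_op p.2 (alg_op p.1 x y) z =
  \sum_(q <- t) alg_op q.1 x (alg_op q.2 y z).
Proof. by case: (algP A) => _ _ _; apply. Qed.

(** Giving 1 o 1 the component 0 in A makes this component of the extended
    products defined everywhere, and multilinear also in the operation. *)
Definition plus_act (o : Omega) (x y : plus A) : A :=
  (y.1 * al o) *: x.2 + (x.1 * be o) *: y.2 + alg_op o x.2 y.2.

Lemma plus_act_linear_gen x y : linear (fun o => plus_act o x y).
Proof.
apply: linear_add (alg_linear_gen _ _).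
by apply: linear_add; apply: linear_form => c o o';
  rewrite linearP mulrDr mulrCA.
Qed.

Lemma plus_act_linearl o y : linear (fun x => plus_act o x y).
Proof.
apply: linear_add; last exact: linear_comp (alg_linearl _ _) (linearP snd).
apply: linear_add; first exact: linear_scale (linearP snd).
by apply: linear_form => c x x'; rewrite /= mulrDl scalerAl.
Qed.

Lemma plus_act_linearr o x : linear (fun y => plus_act o x y).
Proof.
apply: linear_add; last exact: linear_comp (alg_linearr _ _) (linearP snd).
apply: linear_add; last exact: linear_scale (linearP snd).
by apply: linear_form => c y y'; rewrite /= mulrDl scalerAl.
Qed.

Definition plus_star (x y : plus A) : plus A :=
  (x.1 * y.1, plus_act (star P) x y).

Lemma plus_star_linearl y : linear (fun x => plus_star x y).
Proof.
move=> c x x'; congr pair; rewrite /= ?plus_act_linearl //.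
by rewrite mulrDl scalerAl.
Qed.

Lemma plus_star_linearr x : linear (plus_star x).
Proof.
move=> c y y'; congr pair; rewrite /= ?plus_act_linearr //.
by rewrite mulrDr scalerAr.
Qed.

Lemma plus_act_inj o a b : plus_act o (inj a) (inj b) = alg_op o a b.
Proof. by rewrite /plus_act !mul0r !scale0r !add0r. Qed.

Lemma plus_act_inj_one o a : plus_act o (inj a) one = al o *: a.
Proof.
by rewrite /plus_act /= mul1r mul0r (lin0 (alg_linearr _ _)) scaler0 !addr0.
Qed.

Lemma plus_act_one_inj o b : plus_act o one (inj b) = be o *: b.
Proof.
by rewrite /plus_act /= mul1r mul0r (lin0 (alg_linearl _ _)) scaler0 addr0
  add0r.
Qed.

Lemma plus_act_one o : plus_act o one one = 0.
Proof.
by rewrite /plus_act /= (lin0 (alg_linearl _ _)) !scaler0 !addr0.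
Qed.

Lemma injZ (c : k) (a : A) : inj (c *: a) = c *: inj a.
Proof. by congr pair; rewrite /= scaler0. Qed.

Lemma linear_inj : linear (fun a : A => inj a).
Proof. by move=> c a a'; rewrite in_plusP. Qed.

Lemma plus_decomp (x : plus A) : x = x.1 *: one + inj x.2.
Proof.
by case: x => r a; congr pair; rewrite /= ?addr0 ?scaler0 ?add0r // [RHS]mulr1.
Qed.

Lemma plus_star_inj a b : plus_star (inj a) (inj b) = inj (alg_op (star P) a b).
Proof. by rewrite /plus_star plus_act_inj /= mulr0. Qed.

Lemma plus_star_one : plus_star one one = one.
Proof. by rewrite /plus_star plus_act_one /= mulr1. Qed.

Lemma plus_star_inj_one a : plus_star (inj a) one = inj a.
Proof. by rewrite /plus_star plus_act_inj_one /= mul0r alpha_star scale1r. Qed.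

Lemma plus_star_one_inj a : plus_star one (inj a) = inj a.
Proof. by rewrite /plus_star plus_act_one_inj /= mulr0 beta_star scale1r. Qed.

Definition ext_defined (o : Omega) (x y : plus A) :=
  (o == star P) || (x.1 * y.1 == 0).

Lemma ext_opE o x y : ext_op u o x y =
  if ext_defined o x y then Some (x.1 * y.1, plus_act o x y) else None.
Proof. by []. Qed.

Lemma ext_op_star x y : ext_op u (star P) x y = Some (plus_star x y).
Proof. by rewrite ext_opE /ext_defined eqxx. Qed.

End Algebra.

(** ** Relations on A_+ *)

Definition weak_coherence (s t : seq (Omega * Omega)) :=
  [/\ \sum_(p <- s) be p.1 *: p.2 = \sum_(q <- t) be q.1 *: q.2,
      \sum_(p <- s) al p.1 *: p.2 = \sum_(q <- t) be q.2 *: q.1 &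
      \sum_(p <- s) al p.2 *: p.1 = \sum_(q <- t) al q.2 *: q.1].

(** Applying alpha or beta to the equations between operations is how the
    scalar identities for the coefficients are obtained. *)
Lemma form_sumZ (f : {linear Omega -> k^o}) I (r : seq I) (c : I -> k)
    (F : I -> Omega) :
  f (\sum_(i <- r) c i *: F i) = \sum_(i <- r) c i * f (F i).
Proof. by rewrite -(lin_sumZ _ _ _ (linearP f)). Qed.

Section Relation.
Variables (A : algebra P) (x y z : plus A).

Lemma plus_act_suml (s : seq (Omega * Omega)) :
  \sum_(p <- s) plus_act p.2 (x.1 * y.1, plus_act p.1 x y) z =
  (y.1 * z.1 * \sum_(p <- s) al p.1 * al p.2) *: x.2
  + (x.1 * z.1 * \sum_(p <- s) be p.1 * al p.2) *: y.2
  + z.1 *: alg_op (\sum_(p <- s) al p.2 *: p.1) x.2 y.2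
  + (x.1 * y.1 * \sum_(p <- s) be p.2) *: z.2
  + y.1 *: alg_op (\sum_(p <- s) al p.1 *: p.2) x.2 z.2
  + x.1 *: alg_op (\sum_(p <- s) be p.1 *: p.2) y.2 z.2
  + \sum_(p <- s) alg_op p.2 (alg_op p.1 x.2 y.2) z.2.
Proof.
rewrite !(lin_sum _ _ (alg_linear_gen _ _)) !mulr_sumr !scaler_suml.
rewrite !scaler_sumr -!big_split /=; apply: eq_bigr => p _.
rewrite !(linZ (alg_linear_gen _ _)) {1}/plus_act /=.
rewrite !(linD (alg_linearl _ _)) !(linZ (alg_linearl _ _)).
rewrite !scalerDr !scalerA !addrA.
by do !congr (_ + _); congr (_ *: _); ring.
Qed.

Lemma plus_act_sumr (t : seq (Omega * Omega)) :
  \sum_(q <- t) plus_act q.1 x (y.1 * z.1, plus_act q.2 y z) =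
  (y.1 * z.1 * \sum_(q <- t) al q.1) *: x.2
  + (x.1 * z.1 * \sum_(q <- t) be q.1 * al q.2) *: y.2
  + z.1 *: alg_op (\sum_(q <- t) al q.2 *: q.1) x.2 y.2
  + (x.1 * y.1 * \sum_(q <- t) be q.1 * be q.2) *: z.2
  + y.1 *: alg_op (\sum_(q <- t) be q.2 *: q.1) x.2 z.2
  + x.1 *: alg_op (\sum_(q <- t) be q.1 *: q.2) y.2 z.2
  + \sum_(q <- t) alg_op q.1 x.2 (alg_op q.2 y.2 z.2).
Proof.
rewrite !(lin_sum _ _ (alg_linear_gen _ _)) !mulr_sumr !scaler_suml.
rewrite !scaler_sumr -!big_split /=; apply: eq_bigr => p _.
rewrite !(linZ (alg_linear_gen _ _)) {1}/plus_act /=.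
rewrite !(linD (alg_linearr _ _)) !(linZ (alg_linearr _ _)).
rewrite !scalerDr !scalerA !addrA.
rewrite [LHS](ACl (1*2*5*3*6*4*7))%AC /=.
by do !congr (_ + _); congr (_ *: _); ring.
Qed.

(** The two scalar hypotheses are stated with their coefficients in front, so
    that they are void unless definedness of the products makes them true. *)
Lemma plus_relation s t :
  is_relation s t -> weak_coherence s t ->
  (y.1 * z.1) * \sum_(q <- t) al q.1 =
    (y.1 * z.1) * \sum_(q <- t) al q.1 * al q.2 ->
  (x.1 * y.1) * \sum_(p <- s) be p.2 =
    (x.1 * y.1) * \sum_(p <- s) be p.1 * be p.2 ->
  \sum_(p <- s) plus_act p.2 (x.1 * y.1, plus_act p.1 x y) z =
  \sum_(q <- t) plus_act q.1 x (y.1 * z.1, plus_act q.2 y z).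
Proof.
move=> st [c1 c2 c3] ea eb.
have aa : \sum_(p <- s) al p.1 * al p.2 = \sum_(q <- t) al q.1 * al q.2.
  have := congr1 al c3; rewrite !form_sumZ => e.
  by under eq_bigr do rewrite mulrC; rewrite e; under eq_bigr do rewrite mulrC.
have ba : \sum_(p <- s) be p.1 * al p.2 = \sum_(q <- t) be q.1 * al q.2.
  by have := congr1 al c1; rewrite !form_sumZ.
have bb : \sum_(p <- s) be p.1 * be p.2 = \sum_(q <- t) be q.1 * be q.2.
  by have := congr1 be c1; rewrite !form_sumZ.
rewrite plus_act_suml plus_act_sumr ea eb aa ba bb c1 c2 c3.
by rewrite (alg_relation st).
Qed.

End Relation.

Lemma star_relation :
  @is_relation k P [:: (star P, star P)] [:: (star P, star P)].
Proof. by rewrite /is_relation !big_seq1 star_assoc. Qed.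

(** The star relation satisfies the hypotheses of [plus_relation], so star
    stays associative once a unit is adjoined. *)
Lemma plus_starA (A : algebra P) : associative (@plus_star A).
Proof.
move=> x y z; congr pair; rewrite /= ?mulrA //.
have := @plus_relation A x y z _ _ star_relation.
rewrite /weak_coherence !big_seq1 /= alpha_star beta_star !mulr1.
by move=> ->.
Qed.

(** * An algebra with vanishing triple products *)

(** With e = (1, 0), each operation can be read off from its value at (e, e),
    although every triple product vanishes. *)
Definition null_op (o : Omega) (x y : k^o * Omega) : k^o * Omega :=
  (0, (x.1 * y.1) *: o).

Lemma null_op_algebra :
  @is_algebra k P (k^o * Omega)%type null_op.
Proof.
split=> [x y c o o'|o y c x x'|o x c y y'|s t _ x y z].
- by congr pair; rewrite /= ?scaler0 ?addr0 // scalerDr !scalerA mulrC.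
- congr pair; rewrite /= ?scaler0 ?addr0 // mulrDl scalerDl scalerA.
  by rewrite -scalerAl.
- congr pair; rewrite /= ?scaler0 ?addr0 // mulrDr scalerDl scalerA.
  by rewrite -scalerAr.
- by rewrite !big1 // => p _; rewrite /null_op /= ?mul0r ?mulr0 scale0r.
Qed.

Definition null_algebra : algebra P := Algebra null_op_algebra.
Definition null_elt : null_algebra := ((1, 0) : k^o * Omega).

Lemma null_op_elt o : alg_op o null_elt null_elt = (0, o) :> (k^o * Omega).
Proof. by congr pair; rewrite /= mulr1 scale1r. Qed.

Lemma null_suml (s : seq (Omega * Omega)) (x y z : null_algebra) :
  \sum_(p <- s) alg_op p.2 (alg_op p.1 x y) z = 0.
Proof.
by rewrite big1 // => p _; congr pair; rewrite /= ?mul0r scale0r.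
Qed.

Lemma null_sumr (t : seq (Omega * Omega)) (x y z : null_algebra) :
  \sum_(q <- t) alg_op q.1 x (alg_op q.2 y z) = 0.
Proof.
by rewrite big1 // => p _; congr pair; rewrite /= ?mulr0 scale0r.
Qed.

(** * Compatible unit actions *)

Lemma oadd_sum (V : zmodType) I (r : seq I) (d : pred I) (F : I -> V) :
  \big[@oadd V / Some 0]_(i <- r) (if d i then Some (F i) else None) =
  if all d r then Some (\sum_(i <- r) F i) else None.
Proof.
elim: r => [|i r IH] /=; first by rewrite !big_nil.
by rewrite !big_cons IH; case: (d i); case: (all d r).
Qed.

Lemma sum_pair (U V : zmodType) I (r : seq I) (F : I -> U) (G : I -> V) :
  \sum_(i <- r) (F i, G i) = (\sum_(i <- r) F i, \sum_(i <- r) G i).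
Proof. by elim/big_rec3: _ => // i a b c _ ->. Qed.

Section ExtendedSums.
Variables (A : algebra P) (x y z : plus A).

Definition defined_l (p : Omega * Omega) :=
  ext_defined p.1 x y && ext_defined p.2 (x.1 * y.1, plus_act p.1 x y) z.

Definition defined_r (q : Omega * Omega) :=
  ext_defined q.2 y z && ext_defined q.1 x (y.1 * z.1, plus_act q.2 y z).

Lemma ext_suml (s : seq (Omega * Omega)) :
  \big[@oadd _ / Some 0]_(p <- s)
     obind (fun w => ext_op u p.2 w z) (ext_op u p.1 x y) =
  if all defined_l s then
    Some (\sum_(p <- s) x.1 * y.1 * z.1,
          \sum_(p <- s) plus_act p.2 (x.1 * y.1, plus_act p.1 x y) z)
  else None.
Proof.
rewrite -sum_pair -oadd_sum; apply: eq_bigr => p _.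
by rewrite ext_opE /defined_l; case: ifP.
Qed.

Lemma ext_sumr (t : seq (Omega * Omega)) :
  \big[@oadd _ / Some 0]_(q <- t)
     obind (ext_op u q.1 x) (ext_op u q.2 y z) =
  if all defined_r t then
    Some (\sum_(q <- t) x.1 * (y.1 * z.1),
          \sum_(q <- t) plus_act q.1 x (y.1 * z.1, plus_act q.2 y z))
  else None.
Proof.
rewrite -sum_pair -oadd_sum; apply: eq_bigr => p _.
by rewrite ext_opE /defined_r; case: ifP.
Qed.

End ExtendedSums.

Lemma ext_defined_star (A : algebra P) o (x y : plus A) :
  ext_defined o x y -> x.1 * y.1 != 0 -> o = star P.
Proof. by case/orP => [/eqP //|/eqP ->]; rewrite eqxx. Qed.

(** When all operations are the star, the unit components of the two sides
    count the terms, and (C1) makes these counts agree in the field. *)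
Lemma sum_unit_star (s t : seq (Omega * Omega)) :
  weak_coherence s t -> all (pred1 (star P, star P)) s ->
  all (pred1 (star P, star P)) t ->
  \sum_(p <- s) 1 = \sum_(q <- t) 1 :> k.
Proof.
case=> c1 _ _ /allP sS /allP tS; have := congr1 be c1; rewrite !form_sumZ.
rewrite (eq_big_seq (fun=> 1)); last first.
  by move=> p /sS /eqP ->; rewrite beta_star mulr1.
rewrite [RHS](eq_big_seq (fun=> 1)) // => p /tS /eqP ->.
by rewrite beta_star mulr1.
Qed.

Lemma weak_coherence_compatible :
  (forall s t, is_relation s t -> weak_coherence s t) -> compatible u.
Proof.
move=> C A s t st x y z l r; rewrite ext_suml ext_sumr.
case: ifP => // /allP ds [<-]; case: ifP => // /allP dt [<-].
congr pair; last first.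
  apply: plus_relation (C _ _ st) _ _ => //.
    have [->|yz] := eqVneq (y.1 * z.1) 0; first by rewrite !mul0r.
    congr (_ * _); apply: eq_big_seq => q /dt /andP[d _].
    by rewrite (ext_defined_star d yz) alpha_star mulr1.
  have [->|xy] := eqVneq (x.1 * y.1) 0; first by rewrite !mul0r.
  congr (_ * _); apply: eq_big_seq => p /ds /andP[d _].
  by rewrite (ext_defined_star d xy) beta_star mul1r.
(* The unit component: unless its coefficient is 0, every term being defined
   forces all four operations of the relation to be the star. *)
have [xyz|xyz] := eqVneq (x.1 * y.1 * z.1) 0.
  by rewrite !big1 // => p _; rewrite mulrA.
have xy : x.1 * y.1 != 0 by apply: contraNneq xyz => ->; rewrite mul0r.
have yz : y.1 * z.1 != 0.
  by apply: contraNneq xyz; rewrite -mulrA => ->; rewrite mulr0.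
have sS : all (pred1 (star P, star P)) s.
  apply/allP => -[o o'] /ds /andP[/= d d'].
  by rewrite (ext_defined_star d xy) (ext_defined_star d' xyz) /=.
have tS : all (pred1 (star P, star P)) t.
  apply/allP => -[o o'] /dt /andP[/= d d'].
  rewrite (ext_defined_star d yz) (ext_defined_star d') /= //.
  by rewrite mulrA.
rewrite -mulrA -[x.1 * _]mulr1 -!mulr_sumr; congr (_ * _).
exact: sum_unit_star (C _ _ st) sS tS.
Qed.

Lemma compatible_weak_coherence :
  compatible u -> forall s t, is_relation s t -> weak_coherence s t.
Proof.
move=> C s t st.
have sums (x y z : plus null_algebra) :
    x.1 * y.1 = 0 -> y.1 * z.1 = 0 ->
    \sum_(p <- s) plus_act p.2 (x.1 * y.1, plus_act p.1 x y) z =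
    \sum_(q <- t) plus_act q.1 x (y.1 * z.1, plus_act q.2 y z).
  move=> xy yz; have := C _ _ _ st x y z; rewrite ext_suml ext_sumr.
  have -> : all (defined_l x y z) s.
    apply/allP => p _.
    by rewrite /defined_l /ext_defined /= xy mul0r eqxx !orbT.
  have -> : all (defined_r x y z) t.
    apply/allP => p _.
    by rewrite /defined_r /ext_defined /= yz mulr0 eqxx !orbT.
  by move=> /(_ _ _ erefl erefl) [].
have cancel (o o' : Omega) :
    alg_op o null_elt null_elt = alg_op o' null_elt null_elt -> o = o'.
  by rewrite !null_op_elt => -[].
have simp := (mul0r, mulr0, scale0r, scale1r, add0r, addr0).
split; apply: cancel.
- have := sums one (inj null_elt) (inj null_elt).
  rewrite plus_act_suml plus_act_sumr null_suml null_sumr /= !simp.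
  by move/(_ erefl erefl).
- have := sums (inj null_elt) one (inj null_elt).
  rewrite plus_act_suml plus_act_sumr null_suml null_sumr /= !simp.
  by move/(_ erefl erefl).
- have := sums (inj null_elt) (inj null_elt) one.
  rewrite plus_act_suml plus_act_sumr null_suml null_sumr /= !simp.
  by move/(_ erefl erefl).
Qed.

(** * The product on the box tensor product *)

Section Box.
Variables A B : algebra P.
Local Notation T := (tensor (plus A) (plus B)).

(** The first summand is the rule for b ⊗ b' different from 1 ⊗ 1; the second
    one is the rule for 1 ⊗ 1, and its coefficient extracts the components of y
    and y' along the unit.  As [plus_act] vanishes at 1, 1, the summands do not
    interfere. *)
Definition box_form (o : Omega) (x : plus A) (y : plus B)
    (x' : plus A) (y' : plus B) : T :=
  plus_star x x' ⊗ inj (plus_act o y y')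
  + (y.1 * y'.1 : k) *: (inj (plus_act o x x') ⊗ one : T).

Lemma box_mul_exists : exists M : Omega -> T -> T -> T,
  [/\ forall X Y, linear (fun o => M o X Y),
      forall o Y, linear (fun X => M o X Y),
      forall o X, linear (M o X) &
      forall o x y x' y', M o (x ⊗ y) (x' ⊗ y') = box_form o x y x' y'].
Proof.
have linl (y : plus B) : linear (fun x : plus A => x ⊗ y).
  exact: tens_linearl.
have linr (x : plus A) : linear (fun b : B => x ⊗ inj b).
  exact: linear_comp (tens_linearr x) (@linear_inj B).
have lini : linear (fun a : A => inj a ⊗ (one : plus B)).
  exact: linear_comp (linl one) (@linear_inj A).
have /choice[M MP] (o : Omega) : exists M : T -> T -> T,
    [/\ forall Y, linear (fun X => M X Y), forall X, linear (M X) &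
      forall x y x' y', M (x ⊗ y) (x' ⊗ y') = box_form o x y x' y'].
  apply: tensor_bilinear_universal => [y x' y'|x x' y'|x y y'|x y x'].
  - apply: linear_add; last first.
      exact/linear_scale/(linear_comp lini)/plus_act_linearl.
    exact: linear_comp (linl _) (@plus_star_linearl A x').
  - apply: linear_add.
      exact: linear_comp (linr _) (@plus_act_linearl B o y').
    by apply: linear_form => c y y2; rewrite /= mulrDl scalerAl.
  - apply: linear_add; last first.
      exact/linear_scale/(linear_comp lini)/plus_act_linearr.
    exact: linear_comp (linl _) (@plus_star_linearr A x).
  - apply: linear_add.
      exact: linear_comp (linr _) (@plus_act_linearr B o y).
    by apply: linear_form => c y2 y3; rewrite /= mulrDr scalerAr.
have Ml o Y : linear (fun X => M o X Y) by case: (MP o).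
have Mr o X : linear (M o X) by case: (MP o).
have ME o x y x' y' : M o (x ⊗ y) (x' ⊗ y') = box_form o x y x' y'.
  by case: (MP o).
exists M; split=> // X Y c o o'; move: X; apply: tensor_ext => //.
  by apply: linear_add => //; apply: linear_scale.
move=> x y; move: Y; apply: tensor_ext => //.
  by apply: linear_add => //; apply: linear_scale.
move=> x' y'; rewrite !ME.
suff: linear (fun o => box_form o x y x' y') by apply.
apply: linear_add; first exact: linear_comp (linr _) (plus_act_linear_gen _ _).
exact/linear_scale/(linear_comp lini)/plus_act_linear_gen.
Qed.

Definition box_mul : Omega -> T -> T -> T := sval (cid box_mul_exists).

Lemma box_mul_linear_gen X Y : linear (fun o => box_mul o X Y).
Proof. by rewrite /box_mul; case: cid => M [/=]. Qed.

Lemma box_mul_linearl o Y : linear (fun X => box_mul o X Y).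
Proof. by rewrite /box_mul; case: cid => M [/=]. Qed.

Lemma box_mul_linearr o X : linear (box_mul o X).
Proof. by rewrite /box_mul; case: cid => M [/=]. Qed.

Lemma box_mulE o x y x' y' :
  box_mul o (x ⊗ y) (x' ⊗ y') = box_form o x y x' y'.
Proof. by rewrite /box_mul; case: cid => M [/=]. Qed.

Lemma box_mem_tens (x : plus A) (b : B) : x ⊗ inj b \in @box_pred k A B.
Proof.
apply/asboolP; exists 0, (x.1 *: b), [:: (x.2, b)].
rewrite big_seq1 tens0l add0r {1}[x]plus_decomp injZ (linZ (tens_linearr _)).
by rewrite (linD (tens_linearl _)) (linZ (tens_linearl _)).
Qed.

Lemma box_mem_one (a : A) : inj a ⊗ one \in @box_pred k A B.
Proof.
apply/asboolP; exists a, 0, [::].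
by rewrite big_nil tens0r !addr0.
Qed.

Lemma box_mul_mem o X Y : box_mul o X Y \in @box_pred k A B.
Proof.
have [s ->] := tens_span X; have [t ->] := tens_span Y.
rewrite (lin_sum _ _ (box_mul_linearl _ _)) rpred_sum // => p _.
rewrite (lin_sum _ _ (box_mul_linearr _ _)) rpred_sum // => q _.
by rewrite box_mulE rpredD ?rpredZ ?box_mem_tens ?box_mem_one.
Qed.

(** A ⊠ B is spanned by two families only, since a ⊗ b and 1 ⊗ b are both of
    the form x ⊗ b with x in A_+. *)
Lemma box_ext (W : lmodType k) (h h' : T -> W) :
  linear h -> linear h' ->
  (forall x b, h (x ⊗ inj b) = h' (x ⊗ inj b)) ->
  (forall a, h (inj a ⊗ one) = h' (inj a ⊗ one)) ->
  {in @box_pred k A B, h =1 h'}.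
Proof.
move=> hl hl' ht h1 _ /asboolP[a [b [s ->]]].
rewrite !(linD hl) !(linD hl') h1 ht (lin_sum _ _ hl) (lin_sum _ _ hl').
congr (_ + _).
by apply: eq_bigr => p _; rewrite ht.
Qed.

(** The product of the two unit coordinates is 1 at 1 ⊗ 1 and vanishes on
    A ⊠ B. *)
Lemma one_one_not_box :
  (one : plus A) ⊗ (one : plus B) \notin @box_pred k A B.
Proof.
have [||h hl hE] := @tensor_universal k (plus A) (plus B) k^o
    (fun x y => x.1 * y.1).
- by move=> y c x x'; rewrite /= mulrDl scalerAl.
- by move=> x c y y'; rewrite /= mulrDr scalerAr.
apply/negP => m11; have : h (one ⊗ one) = 0.
  move: m11; apply: (box_ext (h' := fun=> 0)) => // [c x y|x b|a].
  - by rewrite scaler0 addr0.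
  - by rewrite hE /= mulr0.
  - by rewrite hE /= mul0r.
by apply/eqP; rewrite hE /= mulr1 oner_eq0.
Qed.

Definition pure (X : T) : Prop := exists a b, X = in_plus a ⊗ in_plus b.

Lemma box_formulaE o (a a' : option A) (b b' : option B) :
  in_plus a ⊗ in_plus b \in @box_pred k A B ->
  in_plus a' ⊗ in_plus b' \in @box_pred k A B ->
  match b, b' with
  | None, None =>
      omap (fun c => c ⊗ one) (ext_op u o (in_plus a) (in_plus a'))
  | _, _ =>
      obind (fun c => omap (tens c) (ext_op u o (in_plus b) (in_plus b')))
            (ext_op u (star P) (in_plus a) (in_plus a'))
  end = Some (box_mul o (in_plus a ⊗ in_plus b) (in_plus a' ⊗ in_plus b')).
Proof.
rewrite box_mulE /box_form ext_op_star !ext_opE /ext_defined.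
case: b b' => [b|] [b'|] ma ma' /=;
  rewrite ?(mul0r, mulr0) ?eqxx ?orbT /= ?scale0r ?addr0 //.
case: a ma => [a|]; last by rewrite (negPf one_one_not_box).
case: a' ma' => [a'|]; last by rewrite (negPf one_one_not_box).
move=> _ _; rewrite plus_act_one tens0r /= mul0r eqxx orbT.
by rewrite mulr1 scale1r add0r.
Qed.

(** The formulas could only be undefined at 1 ⊗ 1, which is not in A ⊠ B; so
    they amount to saying that the operation agrees with [box_mul] on pure
    tensors. *)
Lemma box_formulasP (op : Omega -> box A B -> box A B -> box A B) :
  box_formulas u op <->
  forall o X Y, pure (box_val X) -> pure (box_val Y) ->
    box_val (op o X Y) = box_mul o (box_val X) (box_val Y).
Proof.
split=> [F o X Y [a [b XE]] [a' [b' YE]] | F o a a' b b' X Y XE YE].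
  have mX := valP X; rewrite /= XE in mX.
  have mY := valP Y; rewrite /= YE in mY.
  by case: (etrans (F o _ _ _ _ _ _ XE YE) (box_formulaE o mX mY)) => ->;
    rewrite XE YE.
rewrite F; [|by exists a, b|by exists a', b']; rewrite XE YE.
by apply/esym/box_formulaE; rewrite -?XE -?YE; [apply: (valP X) |
  apply: (valP Y)].
Qed.

Lemma box_mul_tens_tens o x b x' b' :
  box_mul o (x ⊗ inj b) (x' ⊗ inj b') = plus_star x x' ⊗ inj (alg_op o b b').
Proof. by rewrite box_mulE /box_form plus_act_inj /= mul0r scale0r addr0. Qed.

Lemma box_mul_tens_one o x b a :
  box_mul o (x ⊗ inj b) (inj a ⊗ one) = plus_star x (inj a) ⊗ inj (al o *: b).
Proof.
by rewrite box_mulE /box_form plus_act_inj_one /= mul0r scale0r addr0.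
Qed.

Lemma box_mul_one_tens o a x b :
  box_mul o (inj a ⊗ one) (x ⊗ inj b) = plus_star (inj a) x ⊗ inj (be o *: b).
Proof.
by rewrite box_mulE /box_form plus_act_one_inj /= mulr0 scale0r addr0.
Qed.

Lemma box_mul_one_one o a a' :
  box_mul o (inj a ⊗ one) (inj a' ⊗ one) = inj (alg_op o a a') ⊗ one.
Proof.
by rewrite box_mulE /box_form plus_act_one plus_act_inj /= mulr1 scale1r
  tens0r add0r.
Qed.

(** ** Triple products *)

(** For each pattern that leads to one of the five equations, the two sides of
    a relation are the values, at the two sides of that equation, of one and the
    same linear map from operations to A_+ ⊗ B_+. *)

Definition box_suml (s : seq (Omega * Omega)) (X Y Z : T) : T :=
  \sum_(p <- s) box_mul p.2 (box_mul p.1 X Y) Z.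

Definition box_sumr (t : seq (Omega * Omega)) (X Y Z : T) : T :=
  \sum_(q <- t) box_mul q.1 X (box_mul q.2 Y Z).

Let tens_act w b b' (o : Omega) : T := w ⊗ inj (alg_op o b b').

Let act_star_tens a a' x b (o : Omega) : T :=
  plus_star (inj (alg_op o a a')) x ⊗ inj b.

Let star_act_tens x a a' b (o : Omega) : T :=
  plus_star x (inj (alg_op o a a')) ⊗ inj b.

Let tens_actl w b b' : linear (tens_act w b b').
Proof.
apply: linear_comp (tens_linearr w) _.
exact: linear_comp (@linear_inj B) (alg_linear_gen _ _).
Qed.

Let act_star_tensl a a' x b : linear (act_star_tens a a' x b).
Proof.
apply: linear_comp (tens_linearl _) _.
apply: linear_comp (@plus_star_linearl A x) _.
exact: linear_comp (@linear_inj A) (alg_linear_gen _ _).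
Qed.

Let star_act_tensl x a a' b : linear (star_act_tens x a a' b).
Proof.
apply: linear_comp (tens_linearl _) _.
apply: linear_comp (@plus_star_linearr A x) _.
exact: linear_comp (@linear_inj A) (alg_linear_gen _ _).
Qed.

Let tens_injZ (x : plus A) c (b : B) : x ⊗ inj (c *: b) = c *: (x ⊗ inj b).
Proof. by rewrite injZ (linZ (tens_linearr _)). Qed.

Section Triples.
Variables (s : seq (Omega * Omega)) (a a' : A) (x x' : plus A) (b b' : B).

Lemma box_suml_one_tens_tens :
  box_suml s (inj a ⊗ one) (x ⊗ inj b) (x' ⊗ inj b') =
  plus_star (inj a) (plus_star x x')
    ⊗ inj (alg_op (\sum_(p <- s) be p.1 *: p.2) b b').
Proof.
rewrite -[RHS](lin_sumZ _ _ _ (tens_actl _ b b')); apply: eq_bigr => p _.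
rewrite box_mul_one_tens tens_injZ (linZ (box_mul_linearl _ _)).
by rewrite box_mul_tens_tens plus_starA.
Qed.

Lemma box_sumr_one_tens_tens :
  box_sumr s (inj a ⊗ one) (x ⊗ inj b) (x' ⊗ inj b') =
  plus_star (inj a) (plus_star x x')
    ⊗ inj (alg_op (\sum_(q <- s) be q.1 *: q.2) b b').
Proof.
rewrite -[RHS](lin_sumZ _ _ _ (tens_actl _ b b')); apply: eq_bigr => p _.
by rewrite box_mul_tens_tens box_mul_one_tens tens_injZ.
Qed.

Lemma box_suml_tens_one_tens :
  box_suml s (x ⊗ inj b) (inj a ⊗ one) (x' ⊗ inj b') =
  plus_star x (plus_star (inj a) x')
    ⊗ inj (alg_op (\sum_(p <- s) al p.1 *: p.2) b b').
Proof.
rewrite -[RHS](lin_sumZ _ _ _ (tens_actl _ b b')); apply: eq_bigr => p _.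
rewrite box_mul_tens_one tens_injZ (linZ (box_mul_linearl _ _)).
by rewrite box_mul_tens_tens plus_starA.
Qed.

Lemma box_sumr_tens_one_tens :
  box_sumr s (x ⊗ inj b) (inj a ⊗ one) (x' ⊗ inj b') =
  plus_star x (plus_star (inj a) x')
    ⊗ inj (alg_op (\sum_(q <- s) be q.2 *: q.1) b b').
Proof.
rewrite -[RHS](lin_sumZ _ _ _ (tens_actl _ b b')); apply: eq_bigr => p _.
rewrite box_mul_one_tens tens_injZ (linZ (box_mul_linearr _ _)).
by rewrite box_mul_tens_tens.
Qed.

Lemma box_suml_tens_tens_one :
  box_suml s (x ⊗ inj b) (x' ⊗ inj b') (inj a ⊗ one) =
  plus_star x (plus_star x' (inj a))
    ⊗ inj (alg_op (\sum_(p <- s) al p.2 *: p.1) b b').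
Proof.
rewrite -[RHS](lin_sumZ _ _ _ (tens_actl _ b b')); apply: eq_bigr => p _.
by rewrite box_mul_tens_tens box_mul_tens_one tens_injZ plus_starA.
Qed.

Lemma box_sumr_tens_tens_one :
  box_sumr s (x ⊗ inj b) (x' ⊗ inj b') (inj a ⊗ one) =
  plus_star x (plus_star x' (inj a))
    ⊗ inj (alg_op (\sum_(q <- s) al q.2 *: q.1) b b').
Proof.
rewrite -[RHS](lin_sumZ _ _ _ (tens_actl _ b b')); apply: eq_bigr => p _.
rewrite box_mul_tens_one tens_injZ (linZ (box_mul_linearr _ _)).
by rewrite box_mul_tens_tens.
Qed.

Lemma box_suml_one_one_tens :
  box_suml s (inj a ⊗ one) (inj a' ⊗ one) (x ⊗ inj b) =
  plus_star (inj (alg_op (\sum_(p <- s) be p.2 *: p.1) a a')) x ⊗ inj b.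
Proof.
rewrite -[RHS](lin_sumZ _ _ _ (act_star_tensl a a' x b)); apply: eq_bigr => p _.
by rewrite box_mul_one_one box_mul_one_tens tens_injZ.
Qed.

Lemma box_sumr_one_one_tens :
  box_sumr s (inj a ⊗ one) (inj a' ⊗ one) (x ⊗ inj b) =
  plus_star
    (inj (alg_op (\sum_(q <- s) (be q.1 * be q.2) *: star P) a a')) x ⊗ inj b.
Proof.
rewrite -[RHS](lin_sumZ _ _ _ (act_star_tensl a a' x b)); apply: eq_bigr => p _.
rewrite box_mul_one_tens tens_injZ (linZ (box_mul_linearr _ _)).
rewrite box_mul_one_tens tens_injZ scalerA mulrC.
by rewrite /act_star_tens -plus_star_inj plus_starA.
Qed.

Lemma box_suml_tens_one_one :
  box_suml s (x ⊗ inj b) (inj a ⊗ one) (inj a' ⊗ one) =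
  plus_star x
    (inj (alg_op (\sum_(p <- s) (al p.1 * al p.2) *: star P) a a')) ⊗ inj b.
Proof.
rewrite -[RHS](lin_sumZ _ _ _ (star_act_tensl x a a' b)); apply: eq_bigr => p _.
rewrite box_mul_tens_one tens_injZ (linZ (box_mul_linearl _ _)).
rewrite box_mul_tens_one tens_injZ scalerA.
by rewrite /star_act_tens -plus_star_inj plus_starA.
Qed.

Lemma box_sumr_tens_one_one :
  box_sumr s (x ⊗ inj b) (inj a ⊗ one) (inj a' ⊗ one) =
  plus_star x (inj (alg_op (\sum_(q <- s) al q.1 *: q.2) a a')) ⊗ inj b.
Proof.
rewrite -[RHS](lin_sumZ _ _ _ (star_act_tensl x a a' b)); apply: eq_bigr => p _.
by rewrite box_mul_one_one box_mul_tens_one tens_injZ.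
Qed.

End Triples.

Definition coherence (s t : seq (Omega * Omega)) :=
  [/\ \sum_(p <- s) be p.1 *: p.2 = \sum_(q <- t) be q.1 *: q.2,
      \sum_(p <- s) al p.1 *: p.2 = \sum_(q <- t) be q.2 *: q.1,
      \sum_(p <- s) al p.2 *: p.1 = \sum_(q <- t) al q.2 *: q.1,
      \sum_(p <- s) be p.2 *: p.1 =
        \sum_(q <- t) (be q.1 * be q.2) *: star P &
      \sum_(p <- s) (al p.1 * al p.2) *: star P =
        \sum_(q <- t) al q.1 *: q.2].

Lemma box_relation s t : is_relation s t -> coherence s t ->
  {in @box_pred k A B & &, forall X Y Z, box_suml s X Y Z = box_sumr t X Y Z}.
Proof.
move=> st [c1 c2 c3 c4 c5] X Y Z mX mY mZ.
have sl3 r X' Y' : linear (box_suml r X' Y').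
  by apply: linear_bigsum => p; apply: box_mul_linearr.
have sr3 r X' Y' : linear (box_sumr r X' Y').
  apply: linear_bigsum => p.
  exact: linear_comp (box_mul_linearr _ _) (box_mul_linearr _ _).
have sl2 r X' Z' : linear (fun Y' => box_suml r X' Y' Z').
  apply: linear_bigsum => p.
  exact: linear_comp (box_mul_linearl _ _) (box_mul_linearr _ _).
have sr2 r X' Z' : linear (fun Y' => box_sumr r X' Y' Z').
  apply: linear_bigsum => p.
  exact: linear_comp (box_mul_linearr _ _) (box_mul_linearl _ _).
have sl1 r Y' Z' : linear (fun X' => box_suml r X' Y' Z').
  apply: linear_bigsum => p.
  exact: linear_comp (box_mul_linearl _ _) (box_mul_linearl _ _).
have sr1 r Y' Z' : linear (fun X' => box_sumr r X' Y' Z').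
  by apply: linear_bigsum => p; apply: box_mul_linearl.
move: Z mZ; apply: box_ext => // [x3 b3|a3].
- move: Y mY; apply: box_ext => // [x2 b2|a2].
  + move: X mX; apply: box_ext => // [x1 b1|a1].
    * rewrite /box_suml /box_sumr.
      under eq_bigr do rewrite !box_mul_tens_tens -plus_starA.
      under [RHS]eq_bigr do rewrite !box_mul_tens_tens.
      have li : linear (fun b : B => plus_star x1 (plus_star x2 x3) ⊗ inj b).
        exact: linear_comp (tens_linearr _) (@linear_inj B).
      by rewrite -!(lin_sum _ _ li) (alg_relation st).
    * by rewrite box_suml_one_tens_tens box_sumr_one_tens_tens c1.
  + move: X mX; apply: box_ext => // [x1 b1|a1].
    * by rewrite box_suml_tens_one_tens box_sumr_tens_one_tens c2.
    * by rewrite box_suml_one_one_tens box_sumr_one_one_tens c4.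
- move: Y mY; apply: box_ext => // [x2 b2|a2].
  + move: X mX; apply: box_ext => // [x1 b1|a1].
    * by rewrite box_suml_tens_tens_one box_sumr_tens_tens_one c3.
    * have ba : \sum_(p <- s) be p.1 * al p.2 = \sum_(q <- t) be q.1 * al q.2.
        by have := congr1 al c1; rewrite !form_sumZ.
      rewrite /box_suml /box_sumr.
      under eq_bigr do rewrite box_mul_one_tens box_mul_tens_one scalerA
        mulrC -plus_starA tens_injZ.
      under [RHS]eq_bigr do rewrite box_mul_tens_one box_mul_one_tens scalerA
        tens_injZ.
      by rewrite -!scaler_suml ba.
  + move: X mX; apply: box_ext => // [x1 b1|a1].
    * by rewrite box_suml_tens_one_one box_sumr_tens_one_one c5.
    * rewrite /box_suml /box_sumr.
      under eq_bigr do rewrite !box_mul_one_one.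
      under [RHS]eq_bigr do rewrite !box_mul_one_one.
      have li : linear (fun a : A => inj a ⊗ (one : plus B)).
        exact: linear_comp (tens_linearl one) (@linear_inj A).
      by rewrite -!(lin_sum _ _ li) (alg_relation st).
Qed.

End Box.

(** * Coherent unit actions *)

Lemma coherence_coherent :
  (forall s t, is_relation s t -> coherence s t) -> coherent u.
Proof.
move=> C A B; pose op o (X Y : box A B) : box A B :=
  Box (box_mul_mem o (box_val X) (box_val Y)).
exists op; split; first exact/box_formulasP.
split=> [X Y c o o'|o Y c X X'|o X c Y Y'|s t st X Y Z].
- by apply: val_inj; exact: box_mul_linear_gen.
- by apply: val_inj; exact: box_mul_linearl.
- by apply: val_inj; exact: box_mul_linearr.
apply: val_inj; rewrite !raddf_sum /=.
exact: (box_relation st (C _ _ st)) (valP X) (valP Y) (valP Z).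
Qed.

(** The formulas can be used for both steps of a triple product only when the
    intermediate products are pure again, as happens for the triples below. *)
Lemma coherent_box_relation (A B : algebra P) (c : coherent u) s t :
  is_relation s t -> {in @box_pred k A B & &, forall X Y Z,
    pure X -> pure Y -> pure Z ->
    (forall o, pure (box_mul o X Y)) -> (forall o, pure (box_mul o Y Z)) ->
    box_suml s X Y Z = box_sumr t X Y Z}.
Proof.
move=> st X Y Z mX mY mZ pX pY pZ pXY pYZ.
have [op [/box_formulasP F [_ _ _ rel]]] := c A B.
have FXY o : box_val (op o (Box mX) (Box mY)) = box_mul o X Y by rewrite F.
have FYZ o : box_val (op o (Box mY) (Box mZ)) = box_mul o Y Z by rewrite F.
have e := congr1 val (rel s t st (Box mX) (Box mY) (Box mZ)).
rewrite !raddf_sum /= in e.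
apply: etrans (etrans _ e) _; apply: eq_bigr => p _.
- by rewrite F /= ?FXY //.
- by rewrite F /= ?FYZ //.
Qed.

Lemma coherent_coherence :
  coherent u -> forall s t, is_relation s t -> coherence s t.
Proof.
move=> C s t st; pose N := null_algebra.
(* Each equation is read off from one triple made of e ⊗ 1 and 1 ⊗ e. *)
pose Ea : tensor (plus N) (plus N) := inj null_elt ⊗ one.
pose Eb : tensor (plus N) (plus N) := one ⊗ inj null_elt.
pose is_E X := X = Ea \/ X = Eb.
have pE X : is_E X -> pure X.
  by case=> ->; [exists (Some null_elt), None | exists None, (Some null_elt)].
have mE X : is_E X -> X \in @box_pred k N N.
  by case=> ->; rewrite ?box_mem_one ?box_mem_tens.
have pM X Y o : is_E X -> is_E Y -> pure (box_mul o X Y).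
  case=> ->; case=> ->.
  - by rewrite box_mul_one_one; eexists (Some _), None.
  - rewrite box_mul_one_tens plus_star_inj_one.
    by eexists (Some _), (Some _).
  - rewrite box_mul_tens_one plus_star_one_inj.
    by eexists (Some _), (Some _).
  - by rewrite box_mul_tens_tens plus_star_one; eexists None, (Some _).
have rel X Y Z : is_E X -> is_E Y -> is_E Z ->
    box_suml s X Y Z = box_sumr t X Y Z.
  by move=> eX eY eZ; apply: (coherent_box_relation C st); auto.
(* The coordinate along e on one side, times the component in Omega on the
   other, recovers the operation. *)
have canr (o o' : Omega) :
    (inj null_elt : plus N) ⊗ inj (alg_op o null_elt null_elt) =
    inj null_elt ⊗ inj (alg_op o' null_elt null_elt :> N) -> o = o'.
  have [||h _ hE] := @tensor_universal k (plus N) (plus N) Omega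
    (fun x y => x.2.1 *: y.2.2).
  - by move=> y c x x'; rewrite /= scalerDl -scalerA.
  - by move=> x c y y'; rewrite /= scalerDr !scalerA mulrC.
  by move/(congr1 h); rewrite !hE !null_op_elt /= !scale1r.
have canl (o o' : Omega) :
    inj (alg_op o null_elt null_elt) ⊗ (inj null_elt : plus N) =
    inj (alg_op o' null_elt null_elt :> N) ⊗ inj null_elt -> o = o'.
  have [||h _ hE] := @tensor_universal k (plus N) (plus N) Omega
    (fun x y => y.2.1 *: x.2.2).
  - by move=> y c x x'; rewrite /= scalerDr !scalerA mulrC.
  - by move=> x c y y'; rewrite /= scalerDl -scalerA.
  by move/(congr1 h); rewrite !hE !null_op_elt /= !scale1r.
have [eA eB] : is_E Ea /\ is_E Eb by split; [left | right].
split.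
- have := rel _ _ _ eA eB eB.
  rewrite box_suml_one_tens_tens box_sumr_one_tens_tens.
  by rewrite plus_star_one plus_star_inj_one => /canr.
- have := rel _ _ _ eB eA eB.
  rewrite box_suml_tens_one_tens box_sumr_tens_one_tens.
  by rewrite plus_star_inj_one plus_star_one_inj => /canr.
- have := rel _ _ _ eB eB eA.
  rewrite box_suml_tens_tens_one box_sumr_tens_tens_one.
  by rewrite !plus_star_one_inj => /canr.
- have := rel _ _ _ eA eA eB.
  rewrite box_suml_one_one_tens box_sumr_one_one_tens.
  by rewrite !plus_star_inj_one => /canl.
- have := rel _ _ _ eB eA eA.
  rewrite box_suml_tens_one_one box_sumr_tens_one_one.
  by rewrite !plus_star_one_inj => /canl.
Qed.

End PlusProduct.

Theorem theorem2p3 (k : fieldType) (char0 : [pchar k] =i pred0)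
    (P : abqr_operad k) (u : unit_action P) :
  (coherent u <->
   forall s t : seq (generators P * generators P), is_relation s t ->
   [/\ \sum_(p <- s) beta u p.1 *: p.2 = \sum_(q <- t) beta u q.1 *: q.2,
       \sum_(p <- s) alpha u p.1 *: p.2 = \sum_(q <- t) beta u q.2 *: q.1,
       \sum_(p <- s) alpha u p.2 *: p.1 = \sum_(q <- t) alpha u q.2 *: q.1,
       \sum_(p <- s) beta u p.2 *: p.1 =
         \sum_(q <- t) (beta u q.1 * beta u q.2) *: star P &
       \sum_(p <- s) (alpha u p.1 * alpha u p.2) *: star P =
         \sum_(q <- t) alpha u q.1 *: q.2]) /\
  (compatible u <->
   forall s t : seq (generators P * generators P), is_relation s t ->
   [/\ \sum_(p <- s) beta u p.1 *: p.2 = \sum_(q <- t) beta u q.1 *: q.2,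
       \sum_(p <- s) alpha u p.1 *: p.2 = \sum_(q <- t) beta u q.2 *: q.1 &
       \sum_(p <- s) alpha u p.2 *: p.1 = \sum_(q <- t) alpha u q.2 *: q.1]).
Proof.
split; split.
- exact: coherent_coherence.
- exact: coherence_coherent.
- exact: compatible_weak_coherence.
- exact: weak_coherence_compatible.
Qed.
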